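(* Let $G$ be a nonabelian nested $p$-group with chain of centers $G=X_0>X_1>\dots>X_n\ge 1$. Then: (1) $|G:X_1|$ is a perfect square; (2) if $G'\le X_i$ for some $i\in\{1,\dots,n\}$, then $|G:X_j|$ is a perfect square for all $1\le j\le i$; (3) if $N$ is a normal subgroup of $G$ with $[X_1,G]\le N<NG'=X_1$, then $G/N$ is semi-extraspecial; (4) if $n\ge 2$ and $X_2<X_2G'$, then $|G:X_1|=|X_2G':X_2|^2=|G':[X_1,G]|^2$, $X_2\cap G'=[X_1,G]$, and there is a normal subgroup $A$ of $G$ with $X_2\le A<X_1$ such that $G/A$ is ultraspecial.
   Context: $p$ is a prime; all groups are finite. For $\chi\in\mathrm{Irr}(G)$, $Z(\chi)=\{g\in G: |\chi(g)|=\chi(1)\}$. $G$ is nested if for all $\chi,\psi\in\mathrm{Irr}(G)$ either $Z(\chi)\le Z(\psi)$ or $Z(\psi)\le Z(\chi)$; then the distinct subgroups $Z(\chi)$ form a chain $G=X_0>X_1>\dots>X_n\ge1$, the chain of centers. A $p$-group $G$ is semi-extraspecial if for every subgroup $N$ of index $p$ in $Z(G)$ the quotient $G/N$ is extraspecial; $G$ is ultraspecial if it is semi-extraspecial and $|G:Z(G)|=|Z(G)|^2$. *)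

(* Defs.v *)
From HB Require Import structures.
From mathcomp Require Import all_boot all_order all_algebra all_fingroup all_solvable all_field all_character.
Set Implicit Arguments. Unset Strict Implicit. Unset Printing Implicit Defensive.
Import GRing.Theory Num.Theory.

Local Open Scope group_scope.

Definition cfZ (gT : finGroupType) (G : {group gT}) (chi : 'CF(G)) : {set gT} :=
  [set g in G | (`|chi g| == chi 1%g)%R].

Definition nested (gT : finGroupType) (G : {group gT}) : Prop :=
  forall i j : Iirr G, cfZ ('chi_i)%R \subset cfZ ('chi_j)%R \/ cfZ ('chi_j)%R \subset cfZ ('chi_i)%R.

Definition chain_of_centers (gT : finGroupType) (G : {group gT})
    (X : nat -> {group gT}) (n : nat) : Prop :=
  [/\ X 0%N = G,
      (forall k, (k < n)%N -> X k.+1 \proper X k),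
      (forall i : Iirr G, exists2 k, (k <= n)%N & cfZ ('chi_i)%R = X k)
    & (forall k, (k <= n)%N -> exists i : Iirr G, cfZ ('chi_i)%R = X k)].

Definition semi_extraspecial (p : nat) (gT : finGroupType) (H : {set gT}) : Prop :=
  p.-group H /\
  forall M : {group gT}, M \subset 'Z(H) -> #|'Z(H) : M| = p -> extraspecial (H / M).

Definition ultraspecial (p : nat) (gT : finGroupType) (H : {set gT}) : Prop :=
  semi_extraspecial p H /\ #|H : 'Z(H)| = (#|'Z(H)| ^ 2)%N.

(* Main.v *)
Require Import Defs.
From HB Require Import structures.
From mathcomp Require Import all_boot all_order all_algebra all_fingroup all_solvable all_field all_character.
From mathcomp Require Import ring zify.
Set Implicit Arguments. Unset Strict Implicit. Unset Printing Implicit Defensive.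
Import GRing.Theory Num.Theory.

(** For K normal in G, the preimage in G of Z(G/K) is the intersection of the
    Z(chi) with K <= ker chi, and Z(chi) contains X_j iff [X_j, G] <= ker chi;
    so if [X_j, G] is not contained in K, that preimage lies in X_(j+1). In
    particular [X_j, G] <= X_(j+1), the index of a Z(chi) containing G' is
    chi(1)^2, and G/N in (3) has center X_1/N equal to its derived subgroup,
    with the same property inherited by all its quotients.

    For (4), kill a maximal G-invariant subgroup M of [X_1, G] above [X_2, G].
    Now Z = Z(G) = X_2 and W = [X_1, G] has order p and is central. Let
    P = C_G(G'). Duality with G' gives |G : P| <= |G' : G' /\ Z| =: c, and
    the three subgroups lemma gives [P, P] <= Z. For y in P outside X_1 the
    centralizer of yZ in G/Z has index c and contains P/Z, so equals it; hence
    |P : X_1| <= c and |G : X_1| <= c^2 <= |G' : W|^2.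
    The reverse inequality |G' : W|^2 <= |G : X_1| is Beisiegel's bound for
    G/W, i.e. a b-dimensional space of alternating forms on F_p^a all of whose
    nonzero members are nondegenerate satisfies 2b <= a. For odd p it follows
    from Chevalley's argument applied to det^((p-1)/2), the determinant of an
    alternating form being a square; for p = 2, from the divisibility by 2^b of
    a sum of quadratic Gauss sums. *)

Local Open Scope ring_scope.

(** * Alternating matrices *)

(** In characteristic 2 antisymmetry does not force a zero diagonal, hence the second clause. *)
Definition alternating (R : nzRingType) n (A : 'M[R]_n) :=
  A^T = - A /\ forall i, A i i = 0.

(** On the diagonal the terms indexed by (j, k) and (k, j) cancel, which also covers characteristic
    2. *)
Lemma alternating_conj (R : comNzRingType) m n (B : 'M[R]_(m, n)) (A : 'M[R]_n) :
  alternating A -> alternating (B *m A *m B^T).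
Proof.
case=> trA dA; split; first by rewrite !trmx_mul trmxK trA mulNmx mulmxN mulmxA.
move=> i; rewrite mxE; under eq_bigr do rewrite !mxE mulr_suml.
have E : \sum_(j < n) \sum_(k < n) B i k * A k j * B i j =
  \sum_(j < n) (\sum_(k < n | (k < j)%N) (B i k * A k j * B i j + B i j * A j k * B i k)).
  transitivity (\sum_(j < n) (\sum_(k < n | (k < j)%N) B i k * A k j * B i j +
      \sum_(k < n | (j < k)%N) B i k * A k j * B i j)).
    apply: eq_bigr => j _; rewrite (bigID (fun k : 'I_n => (k < j)%N)) /=; congr (_ + _).
    rewrite (bigID (pred1 j)) /= [X in X + _]big1 ?add0r; last first.
      by move=> k /andP[_ /eqP->]; rewrite dA mulr0 mul0r.
    by apply: eq_bigl => k; rewrite -leqNgt ltn_neqAle eq_sym andbC.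
  rewrite big_split /= [X in _ + X](exchange_big_dep xpredT) //= -big_split /=.
  by apply: eq_bigr => j _; rewrite -big_split.
rewrite E big1 // => j _; rewrite big1 // => k _.
have -> : A j k = - A k j by have /matrixP/(_ k j) := trA; rewrite !mxE.
by ring.
Qed.

Lemma alternatingN (R : nzRingType) n (A : 'M[R]_n) :
  alternating A -> alternating (- A).
Proof.
by case=> trA dA; split; [rewrite linearN /= trA | move=> i; rewrite mxE dA oppr0].
Qed.

Lemma alternatingD (R : nzRingType) n (A B : 'M[R]_n) :
  alternating A -> alternating B -> alternating (A + B).
Proof.
move=> [trA dA] [trB dB]; split; first by rewrite linearD /= trA trB opprD.
by move=> i; rewrite mxE dA dB addr0.
Qed.

(** Induction by steps of two: after a simultaneous permutation of rows and columns the 2 x 2 corner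
    has determinant a^2 with a nonzero, and its Schur complement is again alternating. *)
Lemma alternating_det_square (F : fieldType) n (A : 'M[F]_n) :
  alternating A -> exists d, \det A = d ^+ 2.
Proof.
elim/ltn_ind: n A => -[|[|n]] IHn A altA.
- by exists 1; rewrite det_mx00 expr1n.
- by exists 0; rewrite det_mx11 altA.2 expr0n.
have [/existsP[j nzj]|] := boolP [exists j, A ord0 j != 0]; last first.
  move=> /existsPn z; exists 0; rewrite expr0n /= (expand_det_row _ ord0) big1 // => j _.
  by have:= z j; rewrite negbK => /eqP->; rewrite mul0r.
have jn0 : j != ord0 by apply: contraNneq nzj => ->; rewrite altA.2.
pose j1 : 'I_n.+2 := lift ord0 ord0.
pose T : 'M[F]_n.+2 := tperm_mx j1 j.
pose B := T *m A *m T^T.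
have altB : alternating B by exact: alternating_conj.
have detB : \det B = \det A.
  by rewrite !det_mulmx det_tr mulrAC -expr2 det_perm sqrr_sign mul1r.
have B01 : B ord0 j1 != 0.
  rewrite /B /T tr_tperm_mx -xcolE -xrowE !mxE tpermL.
  by rewrite tpermD.
clearbody B; rewrite -detB {detB jn0 nzj T altA A}.
pose C : 'M[F]_(2 + n) := B.
have altC : alternating C by [].
have C01 : C (lshift n 0) (lshift n 1) != 0.
  have e0 : lshift n (0 : 'I_2) = ord0 :> 'I_n.+2 by apply: val_inj.
  have e1 : lshift n (1 : 'I_2) = j1 :> 'I_n.+2 by apply: val_inj.
  by rewrite -e0 -e1 in B01.
rewrite -[\det B]/(\det C); clearbody C => {B j1 altB B01 j}.
set a := C _ _ in C01.
pose D := ulsubmx C; pose E := ursubmx C; pose K := drsubmx C.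
have dlC : dlsubmx C = - E^T.
  apply/matrixP => i j; rewrite !mxE.
  by have /matrixP/(_ (lshift n j) (rshift 2 i)) := altC.1; rewrite !mxE.
have altD : alternating D.
  split; last by move=> i; rewrite !mxE altC.2.
  apply/matrixP => i j; have /matrixP/(_ (lshift n i) (lshift n j)) := altC.1.
  by rewrite !mxE.
have detD : \det D = a ^+ 2.
  have D10 : D 1 0 = - D 0 1 by have /matrixP/(_ 0 1) := altD.1; rewrite !mxE.
  rewrite (expand_det_row _ 0) !big_ord_recl big_ord0 altD.2 mul0r add0r addr0.
  have -> : lift 0 0 = 1 :> 'I_2 by apply: val_inj.
  rewrite /cofactor det_mx11 !mxE /= -[lift _ _]/(lift 0 0 : 'I_2).
  have -> : lift 0 0 = 1 :> 'I_2 by apply: val_inj.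
  have -> : lift 1 0 = 0 :> 'I_2 by apply: val_inj.
  by move: D10; rewrite !mxE => ->; rewrite ?addn0 ?expr1 mulN1r ?mulrN ?mulNr ?opprK expr2.
have Du : D \in unitmx by rewrite unitmxE detD unitfE expf_neq0.
(* The Schur complement of D; the sign is plus because the lower left block is -E^T. *)
pose S := K + E^T *m invmx D *m E.
have altS : alternating S.
  apply: alternatingD; last first.
    rewrite -{2}[E]trmxK; apply: alternating_conj.
    have -> : invmx D = - ((invmx D) *m D *m (invmx D)^T).
      by rewrite mulVmx // mul1mx trmx_inv altD.1 -[- D]scaleN1r invmxZ
        ?invrN1 ?scaleN1r ?opprK // -altD.1 unitmx_tr.
    exact/alternatingN/alternating_conj.
  split; last by move=> i; rewrite !mxE altC.2.
  apply/matrixP => i j; have /matrixP/(_ (rshift 2 i) (rshift 2 j)) := altC.1.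
  by rewrite !mxE.
have [d detS] := IHn n (leqW (leqnn _)) S altS.
exists (a * d); rewrite exprMn -detS -detD.
have -> : C = block_mx 1%:M 0 (- E^T *m invmx D) 1%:M *m block_mx D E 0 S.
  rewrite mulmx_block !mul1mx !mul0mx !addr0 mulmxKV //.
  rewrite [_ *m E + S]addrC /S !mulNmx addrK -dlC.
  by rewrite submxK.
by rewrite det_mulmx det_lblock det_ublock !det1 !mul1r.
Qed.

(** * Spaces of nondegenerate alternating forms over F_p *)

(** Polynomial functions in b variables of total degree at most d, built one variable at a time; the
    induction in [sum_degree_le] follows this construction. *)
Inductive degree_le (F : finFieldType) (b : nat) :
    nat -> ({ffun 'I_b -> F} -> F) -> Prop :=
  | DegCst d c : degree_le d (fun _ => c)
  | DegAdd d f g : degree_le d f -> degree_le d g ->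
      degree_le d (fun m => f m + g m)
  | DegVar d k f : degree_le d f -> degree_le d.+1 (fun m => m k * f m)
  | DegExt d f g : f =1 g -> degree_le d f -> degree_le d g.

Lemma degree_le_sum (F : finFieldType) b d (I : finType)
    (f : I -> {ffun 'I_b -> F} -> F) :
  (forall i, degree_le d (f i)) -> degree_le d (fun m => \sum_i f i m).
Proof.
move=> df; elim: (index_enum I) => [|i s IHs].
  by apply: DegExt _ (DegCst _ d 0) => m; rewrite big_nil.
by apply: DegExt _ (DegAdd (df i) IHs) => m; rewrite big_cons.
Qed.

Lemma degree_le_scale (F : finFieldType) b d c (f : {ffun 'I_b -> F} -> F) :
  degree_le d f -> degree_le d (fun m => c * f m).
Proof.
elim=> {d f} [d c'|d f g _ IHf _ IHg|d k f _ IHf|d f g eqfg _ IHf].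
- exact: DegCst.
- by apply: DegExt _ (DegAdd IHf IHg) => m /=; rewrite mulrDr.
- by apply: DegExt _ (DegVar k IHf) => m /=; rewrite mulrCA.
- by apply: DegExt _ IHf => m /=; rewrite eqfg.
Qed.

Lemma degree_leS (F : finFieldType) b d (f : {ffun 'I_b -> F} -> F) :
  degree_le d f -> degree_le d.+1 f.
Proof.
elim=> {d f} [d c'|d f g _ IHf _ IHg|d k f _ IHf|d f g eqfg _ IHf].
- exact: DegCst.
- exact: DegAdd.
- exact: DegVar.
- exact: DegExt _ IHf.
Qed.

Lemma degree_le_mul (F : finFieldType) b d e (f g : {ffun 'I_b -> F} -> F) :
  degree_le d f -> degree_le e g -> degree_le (d + e)%N (fun m => f m * g m).
Proof.
move=> + dg; elim=> {d f} [d c'|d f h _ IHf _ IHg|d k f _ IHf|d f h eqfg _ IHf].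
- elim: d => [|d IHd]; first exact: degree_le_scale.
  by rewrite addSn; apply: degree_leS.
- by apply: DegExt _ (DegAdd IHf IHg) => m /=; rewrite mulrDl.
- by apply: DegExt _ (DegVar k IHf) => m /=; rewrite mulrA.
- by apply: DegExt _ IHf => m /=; rewrite eqfg.
Qed.

Lemma degree_le_prod (F : finFieldType) b (I : finType)
    (f : I -> {ffun 'I_b -> F} -> F) :
  (forall i, degree_le 1 (f i)) -> degree_le #|I| (fun m => \prod_i f i m).
Proof.
move=> df; rewrite cardE; have -> : enum I = index_enum I by rewrite enumT.
elim: (index_enum I) => [|i s IHs].
  by apply: DegExt _ (DegCst _ 0 1) => m; rewrite big_nil.
by apply: DegExt _ (degree_le_mul (df i) IHs) => m; rewrite big_cons.
Qed.

Lemma degree_le_exp (F : finFieldType) b d n (f : {ffun 'I_b -> F} -> F) :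
  degree_le d f -> degree_le (n * d)%N (fun m => f m ^+ n).
Proof.
move=> df; elim: n => [|n IHn]; first exact: DegExt _ (DegCst _ 0 1).
by apply: DegExt _ (degree_le_mul df IHn) => m; rewrite exprS.
Qed.

Lemma degree_le_det (F : finFieldType) b n (B : 'I_b -> 'M[F]_n) :
  degree_le n (fun m : {ffun 'I_b -> F} => \det (\sum_k m k *: B k)).
Proof.
apply: degree_le_sum => s; apply: degree_le_scale.
have:= @degree_le_prod F b 'I_n (fun i m => (\sum_k m k *: B k) i (s i)).
rewrite card_ord; apply => i.
pose g (k : 'I_b) (m : {ffun 'I_b -> F}) := m k * B k i (s i).
apply: (@DegExt _ _ _ (fun m => \sum_k g k m)).
  by move=> m; rewrite summxE; apply: eq_bigr => k _; rewrite mxE.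
by apply: degree_le_sum => k; apply: (DegVar k (DegCst _ 0 (B k i (s i)))).
Qed.

(** Scaling t by g multiplies the sum by g^e, and some nonzero g has g^e != 1, since otherwise t^e -
    1 would have p - 1 > e roots. For e = 0 the sum is p. *)
Lemma sum_expr_Fp p e : prime p ->
  (e < p.-1)%N -> \sum_(t : 'F_p) t ^+ e = 0.
Proof.
move=> p_pr; case: e => [|e] lte.
  by under eq_bigr do rewrite expr0; rewrite sumr_const card_Fp // pchar_Fp_0.
have [/existsP[g /andP[nzg ge]]|/existsPn allg] := boolP
    [exists g : 'F_p, (g != 0) && (g ^+ e.+1 != 1)].
  set S := \sum_t _; have: (g ^+ e.+1 - 1) * S = 0.
    rewrite mulrBl mul1r mulr_sumr; apply/eqP; rewrite subr_eq0; apply/eqP.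
    under eq_bigr do rewrite -exprMn.
    by rewrite /S [RHS](reindex_inj (mulfI nzg)).
  by move/eqP; rewrite mulf_eq0 subr_eq0 (negPf ge) => /eqP.
have:= @max_unity_roots _ e.+1 (enum (predC1 (0 : 'F_p))) isT.
rewrite -cardE enum_uniq.
have -> : #|predC1 (0 : 'F_p)| = p.-1.
  by rewrite -[in RHS](card_Fp p_pr) -(cardC (pred1 (0 : 'F_p))) card1; apply: eq_card.
rewrite leqNgt lte => H; suff: false by [].
apply: H => //; apply/allP => x; rewrite mem_enum inE /= => nzx.
by have:= allg x; rewrite nzx negbK /= unity_rootE.
Qed.

(** A monomial of degree below b(p-1) has some exponent below p - 1, and its sum over F_p^b factors
    into power sums. *)
Lemma sum_degree_le p b d (f : {ffun 'I_b -> 'F_p} -> 'F_p) : prime p ->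
  degree_le d f -> (d < b * p.-1)%N -> \sum_m f m = 0.
Proof.
move=> p_pr df ltd.
(* Carrying a monomial weight lets the [DegVar] case move its variable into the exponents. *)
suff H : forall e : 'I_b -> nat, (\sum_k e k + d < b * p.-1)%N ->
    \sum_m f m * \prod_k m k ^+ e k = 0.
  have := H (fun _ => 0%N); rewrite big1 // => /(_ ltd) E; rewrite -[RHS]E.
  by apply: eq_bigr => m _; rewrite big1 ?mulr1.
elim: df {ltd} => {d f} [d c|d f g _ IHf _ IHg|d k f _ IHf|d f g eqfg _ IHf] e lte.
- rewrite -mulr_sumr -(bigA_distr_bigA (fun k t => t ^+ e k)).
  have [/existsP[k ek]|/existsPn gee] := boolP [exists k, (e k < p.-1)%N].
    by rewrite (bigD1 k) //= sum_expr_Fp // mul0r mulr0.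
  move: lte; rewrite ltnNge (leq_trans _ (leq_addr _ _)) //.
  rewrite -{1}[b]card_ord -sum_nat_const; apply: leq_sum => k _.
  by rewrite leqNgt.
- by under eq_bigr do rewrite mulrDl; rewrite big_split /= IHf ?IHg ?addr0.
- pose e' j := (e j + (j == k))%N.
  have sume' : (\sum_j e' j = (\sum_j e j).+1)%N.
    by rewrite big_split /= -[RHS]addn1; congr (_ + _)%N;
      rewrite (bigD1 k) //= eqxx big1 // => j /negPf->.
  have lt' : (\sum_j e' j + d < b * p.-1)%N by rewrite sume' addSn -addnS.
  rewrite -[RHS](IHf e' lt').
  apply: eq_bigr => m _; rewrite [m k * _]mulrC -mulrA; congr (_ * _).
  under [RHS]eq_bigr do rewrite exprD.
  rewrite big_split /= mulrC; congr (_ * _).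
  by rewrite (bigD1 k) //= eqxx expr1 big1 ?mulr1 // => j /negPf->.
- by rewrite -[RHS](IHf e lte); apply: eq_bigr => m _; rewrite eqfg.
Qed.

(* det(B_m) is a square, so its (p-1)/2-th power is the indicator of m <> 0,
   although it has degree only a(p-1)/2: Chevalley's argument. *)
Lemma alternating_pencil_odd p a b (B : 'I_b -> 'M['F_p]_a) :
    prime p -> odd p -> (0 < a)%N ->
    (forall k, alternating (B k)) ->
    (forall m : {ffun 'I_b -> 'F_p}, m != 0 -> \sum_k m k *: B k \in unitmx) ->
  (b.*2 <= a)%N.
Proof.
case: a B => // a B p_pr oddp _ altB uB; rewrite leqNgt; apply/negP => ltab.
pose e := (p.-1)./2.
have pe : p = e.*2.+1.
  by rewrite -[LHS](prednK (prime_gt0 p_pr)) -{1}[p.-1]odd_double_half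
    -[odd _]negbK -oddS prednK ?prime_gt0 // oddp.
have e0 : (0 < e)%N by rewrite lt0n; apply: contraTneq (prime_gt1 p_pr) => e0; rewrite pe e0.
have:= sum_degree_le p_pr (degree_le_exp e (degree_le_det B)).
have lt1 : (e * a.+1 < b * p.-1)%N.
  by rewrite [X in (_ < _ * X.-1)%N]pe /= -doubleMr doubleMl mulnC ltn_pmul2r.
move/(_ lt1); rewrite (bigD1 (0 : {ffun 'I_b -> 'F_p})) //= big1 => [|k _];
  last by rewrite ffunE scale0r.
rewrite det0 expr0n eqn0Ngt e0 add0r (eq_bigr (fun _ => 1)); last first.
  move=> m nzm.
  have [d Ed] : exists d, \det (\sum_k m k *: B k) = d ^+ 2.
    apply: alternating_det_square; elim/big_ind: _ => [|*|k _]; [|exact: alternatingD|].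
      by split=> [|i]; rewrite ?trmx0 ?oppr0 ?mxE.
    have [tB dB] := altB k; split; first by rewrite linearZ /= tB scalerN.
    by move=> i; rewrite mxE dB mulr0.
  have:= uB m nzm; rewrite unitmxE Ed unitfE expf_eq0 /= => nzd.
  rewrite -exprM mul2n.
  have := expf_card d; rewrite card_Fp // [X in d ^+ X]pe exprS -[RHS]mulr1.
  exact: mulfI.
(* The sum is the number p^b - 1 of nonzero m, which is -1 in F_p. *)
rewrite sumr_const -(addrK 1 (1 *+ _)) -mulrSr.
have -> : (#|[pred i : {ffun 'I_b -> 'F_p} | i != 0%R]|.+1 = p ^ b)%N.
  rewrite -[in RHS](card_Fp p_pr) -[X in (_ ^ X)%N]card_ord -card_ffun.
  by rewrite -(cardC (pred1 (0 : {ffun 'I_b -> 'F_p}))) card1.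
have b0 : (0 < b)%N by case: (b) ltab.
rewrite natrX pchar_Fp_0 // expr0n eqn0Ngt b0 add0r => /eqP.
by rewrite oppr_eq0 oner_eq0.
Qed.

(** The nontrivial additive character of F_2, with integer values so that divisibility by powers of
    2 is available. *)
Definition sign2 (t : 'F_2) : int := (-1) ^+ (t : nat).

Lemma sign2D : {morph sign2 : s t / s + t >-> s * t}.
Proof.
move=> s t; rewrite /sign2 /= -exprD -[RHS]signr_odd -modn2.
by congr (_ ^+ _).
Qed.

Lemma F2_cases (t : 'F_2) : t = 0 \/ t = 1.
Proof. by case: t => [[|[|//]] lt]; [left|right]; apply: val_inj. Qed.

Lemma addFF2 (t : 'F_2) : t + t = 0.
Proof. by case: (F2_cases t) => ->; apply: val_inj. Qed.

Lemma oppF2 (t : 'F_2) : - t = t.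
Proof. by rewrite -[LHS]add0r -(addFF2 t) addrK. Qed.

(** Writing the second variable as x + u turns the square into a double sum of
    [sign2 (q u + f x u)]. For u != 0 the additive map f(-, u) is nonzero, so its character sum
    vanishes; u = 0 contributes the order of V. *)
Lemma gauss_sum_square (V : finZmodType) (q : V -> 'F_2) (f : V -> V -> 'F_2) :
    (forall x y, q (x + y) = q x + q y + f x y) ->
    (forall x y z, f (x + y) z = f x z + f y z) ->
    (forall u, u != 0 -> exists x, f x u != 0) ->
  (\sum_x sign2 (q x)) ^+ 2 = #|V|%:R.
Proof.
move=> qD fD fnd.
have fx0 x : f x 0 = q 0.
  move: (qD x 0); rewrite addr0 -addrA -{1}[q x]addr0 => /addrI/esym/eqP.
  by rewrite addr_eq0 oppF2 => /eqP.
transitivity (\sum_u \sum_x sign2 (q u + f x u)).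
  rewrite expr2 mulr_suml exchange_big /=.
  apply: eq_bigr => x _; rewrite mulr_sumr (reindex_inj (addrI x)) /=.
  apply: eq_bigr => u _; rewrite -sign2D qD; congr (sign2 _).
  by rewrite !addrA addFF2 add0r.
rewrite (bigD1 0) //= [X in _ + X]big1 => [|u nzu].
  rewrite addr0 (eq_bigr (fun _ => 1)) ?sumr_const // => x _.
  by rewrite fx0 addFF2.
have [x0 nz0] := fnd u nzu.
have {nz0} f1 : f x0 u = 1 by case: (F2_cases (f x0 u)) nz0 => ->.
set S := \sum_x _; suff: S = - S by lia.
rewrite {1}/S (reindex_inj (addrI x0)) -sumrN; apply: eq_bigr => x _.
by rewrite fD f1 addrCA [LHS]sign2D mulN1r.
Qed.

(** If b > h = a/2, a contradiction arises modulo 2^(h+1): every Gauss sum with m != 0 is 2^h or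
    -2^h, the one at m = 0 is 2^a, and their total is divisible by 2^b. *)
Lemma alternating_pencil_2 a b (B : 'I_b -> 'M['F_2]_a) :
    (0 < a)%N ->
    (forall k, alternating (B k)) ->
    (forall m : {ffun 'I_b -> 'F_2}, m != 0 -> \sum_k m k *: B k \in unitmx) ->
  (b.*2 <= a)%N.
Proof.
move=> a0 altB uB.
(* The strict upper triangle of B k defines a quadratic form Q k with polar form f k. *)
pose U k := \matrix_(i, j) (if (i < j)%N then B k i j else 0).
have UB k : B k = U k + (U k)^T.
  apply/matrixP => i j; rewrite !mxE; case: ltngtP => [_|_|/val_inj->];
    rewrite ?addr0 ?add0r ?(altB k).2 //.
  have /matrixP/(_ i j) := (altB k).1; rewrite !mxE => ->.
  by rewrite oppF2.
pose Q k (x : 'rV['F_2]_a) := (x *m U k *m x^T) 0 0.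
pose f k (x y : 'rV['F_2]_a) := (x *m B k *m y^T) 0 0.
have QD k x y : Q k (x + y) = Q k x + Q k y + f k x y.
  have addE (M N : 'M['F_2]_1) : (M + N) 0 0 = M 0 0 + N 0 0 by rewrite mxE.
  rewrite /Q /f UB [(x + y)^T]linearD /= !(mulmxDl, mulmxDr) !addE.
  have -> : (x *m (U k)^T *m y^T) 0 0 = (y *m U k *m x^T) 0 0.
    by rewrite -[in RHS](trmxK (_ *m x^T)) [in RHS]mxE !trmx_mul trmxK mulmxA.
  by rewrite -!addrA; congr (_ + _); rewrite addrCA [in RHS]addrCA;
    congr (_ + _); rewrite addrC.
pose S (m : {ffun 'I_b -> 'F_2}) := \sum_x sign2 (\sum_k m k * Q k x).
have S2 m : m != 0 -> S m ^+ 2 = (2 ^ a)%:R.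
  move=> nzm; rewrite (@gauss_sum_square _ _ (fun x y => \sum_k m k * f k x y)).
  - by rewrite card_mx mul1n card_Fp.
  - by move=> x y; rewrite -!big_split /=; apply: eq_bigr => k _; rewrite QD !mulrDr.
  - move=> x y z; rewrite -big_split /=; apply: eq_bigr => k _.
    by rewrite -mulrDr /f !mulmxDl mxE.
  move=> u nzu; apply/existsP; apply: contraNT nzu => /existsPn f0.
  have E x : \sum_k m k * f k x u = (x *m (\sum_k m k *: B k) *m u^T) 0 0.
    rewrite mulmx_sumr mulmx_suml summxE; apply: eq_bigr => k _.
    by rewrite -scalemxAr -scalemxAl mxE.
  rewrite -[u]trmxK trmx_eq0 -(mulKmx (uB m nzm) u^T).
  suff -> : (\sum_k m k *: B k) *m u^T = 0 by rewrite mulmx0.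
  apply/matrixP => i j; rewrite ord1 [RHS]mxE.
  by have:= f0 (delta_mx 0 i); rewrite negbK E -mulmxA -rowE mxE => /eqP.
(* Evenness of a is read off from some nonzero m; if there is none, b = 0. *)
have [m0 nzm0|allz] := pickP (fun m : {ffun 'I_b -> 'F_2} => m != 0); last first.
  suff -> : b = 0%N by [].
  have := card_ffun 'I_b 'F_2; rewrite (@eq_card1 _ (0 : {ffun 'I_b -> 'F_2})).
    rewrite !card_ord; case: (b) => // b'; rewrite expnS mul2n -addnn.
    by have:= expn_gt0 2 b'; case: (2 ^ b')%N => // -[|?].
  by move=> m; have:= allz m; rewrite !inE => /negbFE.
have [h ah] : exists h, a = h.*2.
  exists (logn 2 `|S m0|).
  have := congr1 (fun z : int => logn 2 `|z|) (S2 m0 nzm0).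
  by rewrite abszX lognX natz absz_nat pfactorK // => E; rewrite -mul2n E.
have Sm m : m != 0 -> `|S m|%N = (2 ^ h)%N.
  move=> nzm; apply/eqP; rewrite -(eqn_exp2r _ _ (isT : (0 < 2)%N)).
  by rewrite -abszX S2 // natz absz_nat ah -muln2 expnM.
(* For fixed x the sum over m is a product of b factors, each equal to 2 or 0. *)
have dvdS : ((2 ^+ b : int) %| \sum_m S m)%Z.
  rewrite exchange_big /=; apply: rpred_sum => x _.
  have -> : \sum_(m : {ffun 'I_b -> 'F_2}) sign2 (\sum_k m k * Q k x) =
      \prod_(k < b) \sum_t sign2 (t * Q k x).
    rewrite bigA_distr_bigA; apply: eq_bigr => m _.
    by rewrite (big_morph _ sign2D (erefl _)).
  have -> : 2 ^+ b = \prod_(k < b) (2 : int) by rewrite prodr_const card_ord.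
  elim/big_ind2: _ => // [? ? ? ?|k _]; first exact: dvdz_mul.
  have [z|z] := F2_cases (Q k x); rewrite z.
    by rewrite (eq_bigr (fun _ => 1)) => [|t _]; rewrite ?sumr_const ?card_ord ?mulr0.
  by rewrite big_ord_recl big_ord1.
rewrite ah leq_double leqNgt; apply/negP => lthb.
have h0 : (0 < h)%N by move: a0; rewrite ah double_gt0.
have E0 : S 0 = (2 ^ a)%:R.
  rewrite /S (eq_bigr (fun _ => 1)) ?sumr_const ?card_mx ?mul1n ?card_ord // => x _.
  by rewrite big1 // => k _; rewrite ffunE mul0r.
have e2 : 2 ^+ h = (2 ^ h)%N :> int by rewrite -natz natrX.
have dvdD k : (h.+1 <= k)%N -> ((2 ^+ h.+1 : int) %| 2 ^+ k)%Z.
  by move=> le; rewrite -(subnK le) exprD dvdz_mull.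
(* Each term with m != 0 is 0 or -2^(h+1). What remains is S 0 - 2^h, and 2^(h+1) divides S 0 =
   2^(2h), so it would divide 2^h. *)
have : ((2 ^+ h.+1 : int) %| \sum_m (S m - 2 ^+ h))%Z.
  rewrite sumrB rpredB //; first exact: dvdz_trans (dvdD b lthb) dvdS.
  rewrite sumr_const card_ffun !card_ord -[X in X \in _]mulr_natr natrX -exprD.
  by apply: dvdD; rewrite addnC (leq_trans lthb) ?leq_addr.
rewrite (bigD1 (0 : {ffun 'I_b -> 'F_2})) //= rpredDr; last first.
  apply: rpred_sum => m nzm; have := Sm m nzm.
  case: (S m) => n; rewrite ?NegzE ?abszN absz_nat => ->.
    by rewrite -e2 subrr rpred0.
  by rewrite -e2 -opprD -mulr2n -[X in - X]mulr_natl -exprS rpredN dvdzz.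
rewrite E0 rpredBl; last first.
  by rewrite natrX; apply: dvdD; rewrite ah -addnn -addn1 leq_add2l.
move=> dvdh; have: ((2 ^+ h.+1 : int) %| 2 ^+ h)%Z by [].
by rewrite dvdzE !abszX dvdn_Pexp2l // ltnn.
Qed.

(** The coordinates of f give b alternating matrices. If x != 0 is killed by their combination with
    coefficients m, choosing y with f x y the k-th unit vector gives m_k = 0; so nonzero
    combinations are invertible. *)
Lemma alternating_map_dim p a b (f : 'rV['F_p]_a -> 'rV['F_p]_a -> 'rV['F_p]_b) :
    prime p -> (0 < a)%N ->
    (forall x y z, f (x + y) z = f x z + f y z) ->
    (forall x y z, f x (y + z) = f x y + f x z) ->
    (forall x, f x x = 0) ->
    (forall x, x != 0 -> forall w, exists y, f x y = w) ->
  (b.*2 <= a)%N.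
Proof.
move=> p_pr a0 fDl fDr fxx fsurj.
have f0l y : f 0 y = 0 by apply: (addrI (f 0 y)); rewrite -fDl !addr0.
have f0r x : f x 0 = 0 by apply: (addrI (f x 0)); rewrite -fDr !addr0.
(* Scalars of F_p are multiples of 1, so additivity gives linearity. *)
have fZl c x y : f (c *: x) y = c *: f x y.
  rewrite -[c]natr_Zp !scaler_nat; elim: (nat_of_ord c) => [|n IHn];
    first by rewrite !mulr0n f0l.
  by rewrite !mulrS fDl IHn.
have fZr c x y : f x (c *: y) = c *: f x y.
  rewrite -[c]natr_Zp !scaler_nat; elim: (nat_of_ord c) => [|n IHn];
    first by rewrite !mulr0n f0r.
  by rewrite !mulrS fDr IHn.
pose B k := \matrix_(i, j) f (delta_mx 0 i) (delta_mx 0 j) 0 k.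
have fE x y k : f x y 0 k = (x *m B k *m y^T) 0 0.
  rewrite {1}[x]row_sum_delta (big_morph (f^~ y) (fun x z => fDl x z y) (f0l y)).
  rewrite -mulmxA mxE summxE; apply: eq_bigr => i _; rewrite fZl mxE; congr (_ * _).
  rewrite {1}[y]row_sum_delta (big_morph _ (fDr _) (f0r _)) mxE summxE.
  by apply: eq_bigr => j _; rewrite fZr !mxE mulrC.
have fsk x y : f x y = - f y x.
  have := fxx (x + y); rewrite fDl !fDr !fxx addr0 add0r => /eqP.
  by rewrite addr_eq0 => /eqP.
have altB k : alternating (B k).
  by split=> [|i]; [apply/matrixP => i j|]; rewrite !mxE ?fxx ?mxE // fsk mxE.
have uB (m : {ffun 'I_b -> 'F_p}) : m != 0 -> \sum_k m k *: B k \in unitmx.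
  move=> nzm; rewrite -row_free_unit; apply: inj_row_free => x xB0.
  apply: contraNeq nzm => nzx; apply/eqP/ffunP => k; rewrite ffunE.
  have [y fy] := fsurj x nzx (delta_mx 0 k).
  have : (x *m (\sum_k m k *: B k) *m y^T) 0 0 = 0 by rewrite xB0 mul0mx mxE.
  rewrite mulmx_sumr mulmx_suml summxE (bigD1 k) //= big1 => [|j njk].
    by rewrite addr0 -scalemxAr -scalemxAl mxE -fE fy mxE !eqxx mulr1.
  by rewrite -scalemxAr -scalemxAl mxE -fE fy mxE (negPf njk) andbF mulr0.
have [p2|odd_p] := even_prime p_pr; last exact: alternating_pencil_odd altB uB.
by subst p; apply: alternating_pencil_2 altB uB.
Qed.

Local Open Scope group_scope.

(** * Groups in which the centers of nonabelian quotients are bounded *)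

(* For every nonabelian quotient G/K, the preimage of Z(G/K) lies in Y. *)
Definition centers_within (gT : finGroupType) (G Y : {set gT}) : Prop :=
  forall K : {group gT}, K <| G -> ~~ (G^`(1) \subset K) ->
  forall x, x \in G -> (forall g, g \in G -> [~ x, g] \in K) -> x \in Y.

Lemma centers_within_quotient (gT : finGroupType) (G N : {group gT}) (Y : {set gT}) :
  N <| G -> centers_within G Y -> centers_within (G / N) (Y / N).
Proof.
move=> nNG cwY Kb nKb ntd xb xbG xbK; have nN := normal_norm nNG.
have [K defK sNK nKG] := inv_quotientN nNG nKb.
have nNK : N <| K by apply: normalS nNG => //; apply: normal_sub.
case/morphimP: xbG => x Nx Gx def_xb; rewrite def_xb; apply: mem_morphim => //.
apply: (cwY K nKG) => // [|g Gg].
  by apply: contra ntd => sGK; rewrite -quotient_der // defK quotientS.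
rewrite -(quotientGK nNK) mem_morphpre /= ?groupR ?(subsetP nN g) //.
rewrite -defK morphR ?(subsetP nN g) //.
by rewrite -def_xb xbK ?mem_quotient.
Qed.

(** In class at most two, g -> [x, g] is a homomorphism. *)
Lemma comm_set_group (gT : finGroupType) (G : {group gT}) x :
  G^`(1) \subset 'Z(G) -> x \in G -> group_set [set [~ x, g] | g in G].
Proof.
move=> /subsetP sG'Z Gx; apply/group_setP; split.
  by apply/imsetP; exists 1; rewrite ?comm1g ?commg1.
move=> _ _ /imsetP[g Gg ->] /imsetP[h Gh ->]; apply/imsetP; exists (h * g); rewrite ?groupM //.
rewrite commgMJ; congr (_ * _); apply/esym/conjg_fixP/commgP.
have /centerP[_ cxh] : [~ x, h] \in 'Z(G) by rewrite sG'Z ?mem_commg.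
exact: cxh.
Qed.

(** The set K of all [x, g] is a central subgroup, and x is central modulo K; were K smaller than
    G', x would lie in Y. *)
Lemma centers_within_comm (gT : finGroupType) (G : {group gT}) (Y : {set gT}) x :
    G^`(1) \subset 'Z(G) -> centers_within G Y -> x \in G -> x \notin Y ->
  G^`(1) = [set [~ x, g] | g in G].
Proof.
move=> sG'Z cwY Gx nYx; apply/eqP; rewrite eqEsubset andbC.
have sCG' : [set [~ x, g] | g in G] \subset G^`(1).
  by apply/subsetP => _ /imsetP[g Gg ->]; rewrite mem_commg.
rewrite sCG'; apply: contraR nYx => ntd.
pose K := group (comm_set_group sG'Z Gx).
have nKG : K <| G.
  apply: sub_center_normal; exact: subset_trans sCG' sG'Z.
by apply: (cwY K) => // g Gg; apply/imsetP; exists g.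
Qed.

(** Take for K the group generated by the p-th powers in G': it lies in the Frattini subgroup of G',
    hence is proper, and [x^p, g] = [x, g]^p lies in it. *)
Lemma centers_within_expp (gT : finGroupType) (G : {group gT}) (Y : {set gT}) (p : nat) x :
    p.-group G -> G^`(1) \subset 'Z(G) -> G^`(1) != 1 -> centers_within G Y ->
  x \in G -> x ^+ p \in Y.
Proof.
move=> pG sG'Z ntG' cwY Gx; have pG' := pgroupS (der_sub 1 G) pG.
apply: (cwY ('Mho^1(G^`(1)))%G); rewrite ?groupX //=.
- exact: char_normal_trans (Mho_char _ _) (der_normal 1 G).
- have := proper_subn (Phi_proper ntG'); apply: contra => /subset_trans; apply.
  by rewrite (Phi_joing pG') joing_subr.
move=> g Gg; have G'xg : [~ x, g] \in G^`(1) by rewrite mem_commg.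
rewrite commXg; last by have /centerP[_ /(_ x Gx)] := subsetP sG'Z _ G'xg.
by rewrite -{1}[p]expn1; apply: Mho_p_elt => //; apply: mem_p_elt pG' _.
Qed.

Lemma centers_within_abelem_quotient (gT : finGroupType) (G Y : {group gT}) (p : nat) :
    prime p -> p.-group G -> G^`(1) \subset 'Z(G) -> G^`(1) != 1 ->
    centers_within G Y -> G^`(1) \subset Y -> Y <| G ->
  p.-abelem (G / Y).
Proof.
move=> p_pr pG sG'Z ntG' cwY sG'Y nYG; apply/abelemP => //; split.
  exact: sub_der1_abelian.
move=> _ /morphimP[x Nx Gx ->]; rewrite -morphX //=; apply: coset_id.
exact: centers_within_expp cwY Gx.
Qed.

(** For x outside the center every element of G' is some [x, g], and [x, g]^p = [x^p, g] = 1 since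
    x^p is central. *)
Lemma centers_within_abelem_der (gT : finGroupType) (G : {group gT}) (p : nat) :
    prime p -> p.-group G -> G^`(1) \subset 'Z(G) ->
    centers_within G 'Z(G) -> p.-abelem G^`(1).
Proof.
move=> p_pr pG sG'Z cwZ; have [->|ntG'] := eqsVneq G^`(1) 1; first exact: abelem1.
have abG' : abelian G^`(1) := abelianS sG'Z (center_abelian G).
have /subsetPn[x Gx nZx] : ~~ (G \subset 'Z(G)).
  apply: contra ntG' => sGZ; rewrite -subG1 -(derG1P (abelianS sGZ (center_abelian G))).
  exact: subxx.
apply/abelemP => //; split=> // z /=; rewrite (centers_within_comm sG'Z cwZ Gx nZx).
case/imsetP=> g Gg ->; have G'xg : [~ x, g] \in G^`(1) by rewrite mem_commg.
rewrite -commXg; last by have /centerP[_ /(_ x Gx)] := subsetP sG'Z _ G'xg.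
have /centerP[_ cxp] := centers_within_expp pG sG'Z ntG' cwZ Gx.
by apply/eqP/commgP; apply: cxp.
Qed.

(** Commutation induces an alternating biadditive map from G/Z(G) to G', both elementary abelian. By
    [centers_within_comm] each nonzero row is onto, so [alternating_map_dim] applies. *)
Lemma card_der1_bound (gT : finGroupType) (G : {group gT}) (p : nat) :
    prime p -> p.-group G -> G^`(1) \subset 'Z(G) -> centers_within G 'Z(G) ->
  (#|G^`(1)| ^ 2 <= #|G : 'Z(G)|)%N.
Proof.
move=> p_pr pG sG'Z cwZ; have [->|ntG'] := eqsVneq G^`(1) 1.
  by rewrite cards1 exp1n.
have abE := centers_within_abelem_der p_pr pG sG'Z cwZ.
have nZ : 'Z(G) <| G := center_normal G.
have nN := normal_norm nZ.
have abV := centers_within_abelem_quotient p_pr pG sG'Z ntG' cwZ sG'Z nZ.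
have ntV : G / 'Z(G) != 1.
  apply: contra ntG'; rewrite -subG1 quotient_sub1 // => sGZ.
  by apply/eqP/derG1P; apply: abelianS sGZ (center_abelian G).
pose r u := repr (rVabelem abV ntV u).
have rP u : r u \in G /\ coset 'Z(G) (r u) = rVabelem abV ntV u.
  have /morphimP[x Nx Gx def_x] := mem_rVabelem abV ntV u.
  have Eu : coset 'Z(G) (r u) = rVabelem abV ntV u by rewrite coset_reprK.
  split=> //; rewrite -(quotientGK nZ) mem_morphpre ?repr_coset_norm //=.
  by rewrite Eu mem_rVabelem.
have G'r x y : x \in G -> y \in G -> [~ x, y] \in G^`(1) by move=> *; rewrite mem_commg.
(* Commutators depend only on cosets of the center, so the choice of [r] is immaterial. *)
have comm_eq x y z : x \in G -> y \in G -> z \in G ->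
    coset 'Z(G) x = coset 'Z(G) y -> [~ x, z] = [~ y, z].
  move=> Gx Gy Gz /rcoset_kercosetP; rewrite !(subsetP nN) // => /(_ isT isT).
  case/rcosetP => c Zc ->; rewrite commMgJ.
  have /centerP[Gc cc] := Zc.
  have -> : [~ c, z] = 1 by apply/eqP/commgP/cc.
  by rewrite conj1g mul1g.
pose f u v : 'rV['F_p]_('dim G^`(1)) := abelem_rV abE ntG' [~ r u, r v].
have abEV : #|G^`(1)| = (p ^ 'dim G^`(1))%N.
  by rewrite -(card_abelem_rV abE ntG') card_mx mul1n card_Fp.
have abVV : #|G : 'Z(G)| = (p ^ 'dim (G / 'Z(G)))%N.
  by rewrite -card_quotient // -(card_abelem_rV abV ntV) card_mx mul1n card_Fp.
rewrite abEV abVV -expnM leq_exp2l ?prime_gt1 // muln2.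
have fN x y : f x y = (- f y x)%R.
  by rewrite /f -abelem_rV_V ?invg_comm // G'r ?(rP _).1.
have fD x y z : f (x + y)%R z = (f x z + f y z)%R.
  have [[Gx Ex] [Gy Ey] [Gz Ez]] := And3 (rP x) (rP y) (rP z).
  have [Gxy Exy] := rP (x + y)%R.
  rewrite /f -abelem_rV_M ?G'r //; congr (abelem_rV _ _ _).
  rewrite (comm_eq _ (r x * r y)) ?groupM //; last first.
    by rewrite [RHS]morphM ?(subsetP nN) //= Exy Ex Ey rVabelemD.
  rewrite commMgJ; congr (_ * _); apply/conjg_fixP/commgP.
  have /centerP[_ cxz] := subsetP sG'Z _ (G'r _ _ Gx Gz).
  exact: cxz.
apply: (@alternating_map_dim p _ _ f) => //.
- by move=> x y z; rewrite fN fD opprD -!fN.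
- by move=> x; rewrite /f commgg abelem_rV_1.
move=> x nzx w; have [Gx Ex] := rP x.
have nZx : r x \notin 'Z(G).
  apply: contra nzx => Zx; rewrite coset_id // in Ex.
  by rewrite -(inj_eq (@rVabelem_inj _ _ _ abV ntV)) rVabelem0 -Ex.
have := mem_rVabelem abE ntG' w; rewrite /= {1}(centers_within_comm sG'Z cwZ Gx nZx).
case/imsetP=> g Gg Ew; exists (abelem_rV abV ntV (coset 'Z(G) g)).
set y := abelem_rV _ _ _; have [Gy Ey] := rP y.
rewrite abelem_rV_K ?mem_quotient // in Ey.
rewrite -[RHS](rVabelemK abE ntG') Ew /f; congr (abelem_rV _ _ _).
by rewrite -[LHS]invg_comm -[RHS]invg_comm (comm_eq _ _ _ Gy Gg Gx Ey).
Qed.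

(** * Index bounds when G' is not central *)

Lemma classE_comm (gT : finGroupType) (A : {set gT}) x :
  x ^: A = x *: [set [~ x, g] | g in A].
Proof.
apply/setP => y; apply/imsetP/lcosetP => [[g Ag ->]|[_ /imsetP[g Ag ->] ->]].
  by exists [~ x, g]; rewrite ?conjg_mulR //; apply/imsetP; exists g.
by exists g; rewrite // conjg_mulR.
Qed.

Lemma leq_index_setI (gT : finGroupType) (G A B : {group gT}) :
  A \subset G -> (#|G : A :&: B| <= #|G : A| * #|G : B|)%N.
Proof.
move=> sAG; rewrite -(Lagrange_index sAG (subsetIl A B)) leq_mul2l indexgI.
by rewrite subset_leq_card ?orbT ?imsetS.
Qed.

(* Adding a generator to Y enlarges the index of its centralizer at most by the
   factor p = #|W|, because all commutators involved lie in W. *)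
Lemma index_cent_leq (gT : finGroupType) (G Y W : {group gT}) (p : nat) :
    p.-group G -> Y \subset G -> #|W| = p -> [~: Y, G] \subset W ->
  (#|G : 'C_G(Y)| <= #|Y : Y :&: 'Z(G)|)%N.
Proof.
move=> pG sYG oW sYGW; set Y0 := (Y :&: 'Z(G))%G.
suff H m (D : {group gT}) : (#|D| <= m)%N -> Y0 \subset D -> D \subset Y ->
    (#|G : 'C_G(D)| <= #|D : Y0|)%N by apply: (H #|Y| Y); rewrite // subsetIl.
elim: m D => [|m IHm] D; first by rewrite leqNgt cardG_gt0.
move=> leDm sY0D sDY; have sDG := subset_trans sDY sYG.
have [eqD|[M maxM sY0M]] := maximal_exists sY0D.
  suff /setIidPl-> : G \subset 'C(D) by rewrite indexgg indexg_gt0.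
  by rewrite -eqD centsC subIset // subsetIr orbT.
have [sMD nsDM] := andP (maxgroupp maxM); have /subsetPn[y Dy nMy] := nsDM.
have pD := pgroupS sDG pG; have nMD := p_maximal_normal pD maxM.
have defD : M * <[y]> = D by apply: mulg_normal_maximal; rewrite ?cycle_subG.
have -> : 'C_G(D) = 'C_G(M) :&: 'C_G[y].
  by rewrite -defD centM cent_cycle [LHS]setIIr.
rewrite -(Lagrange_index sMD sY0M) (p_maximal_index pD maxM) mulnC.
apply: leq_trans (leq_index_setI _ (subsetIl _ _)) _; apply: leq_mul.
  apply: IHm; rewrite ?(subset_trans sMD) //.
  by rewrite -ltnS (leq_trans _ leDm) // proper_card // /proper sMD.
rewrite index_cent1 classE_comm card_lcoset -oW subset_leq_card //.
apply/subsetP => _ /imsetP[g Gg ->]; apply: (subsetP sYGW).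
by rewrite mem_commg ?(subsetP sDY).
Qed.

Lemma card_quotient_index (gT : finGroupType) (G N : {group gT}) :
  G \subset 'N(N) -> #|G / N| = #|G : N :&: G|.
Proof.
move=> nNG; rewrite -(card_isog (second_isog nNG)) card_quotient //.
by rewrite normsI ?normG.
Qed.

(** With P = C_G(G'), both |G : P| and |P : Y| are at most c. *)
Lemma index_centers_leq (gT : finGroupType) (G Y : {group gT}) (p : nat) :
    prime p -> p.-group G -> Y <| G -> G^`(1) \subset Y -> centers_within G Y ->
    [~: Y, G] \subset 'Z(G) -> #|[~: Y, G]| = p -> ~~ (G^`(1) \subset 'Z(G)) ->
  (#|G : Y| <= #|G^`(1) : G^`(1) :&: 'Z(G)| ^ 2)%N.
Proof.
move=> p_pr pG nYG sG'Y cwY sWZ oW nsG'Z; set c := #|_ : _ :&: _|.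
have [sYG _] := andP nYG; have nZG := center_normal G; have [sZG nZ] := andP nZG.
have sZY : 'Z(G) \subset Y.
  apply/subsetP => x Zx; have /centerP[Gx cx] := Zx.
  apply: (cwY _ nZG nsG'Z) => // g Gg.
  by have /eqP-> : [~ x, g] == 1 by apply/commgP/cx.
pose P := 'C_G(G^`(1))%G.
have leGP : (#|G : P| <= c)%N.
  apply: (@index_cent_leq _ _ _ [~: Y, G]%G p) => //; first exact: der_sub.
  by rewrite commSg.
have sPG : P \subset G := subsetIl _ _.
have sYP : Y \subset P.
  rewrite subsetI sYG centsC -[G^`(1)]/[~: G, G]; apply/commG1P.
  have comm1 : [~: Y, G, G] :=: 1.
    by apply/commG1P; apply: subset_trans sWZ (subsetIr _ _).
  by apply: three_subgroup; rewrite // [[~: G, Y]]commGC.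
(* [P, G] lies in G', which P centralizes, so [P, P, G] = 1. *)
have sPPZ : [~: P, P] \subset 'Z(G).
  have sPPG : [~: P, P] \subset G by rewrite comm_subG.
  rewrite subsetI sPPG.
  have cPG' : [~: G^`(1), P] :=: 1 by apply/commG1P; rewrite centsC subsetIr.
  apply/commG1P; apply: three_subgroup; apply/trivgP; rewrite -cPG'.
    by rewrite commSg // (subset_trans (commSg _ sPG)).
  by rewrite commSg // commgS.
pose Q := (G / 'Z(G))%G.
have defQ' : Q^`(1) = G^`(1) / 'Z(G) by rewrite quotient_der.
have oQ' : #|Q^`(1)| = c.
  by rewrite defQ' card_quotient_index ?(subset_trans (der_sub 1 G)) // setIC.
have sQ'Z : Q^`(1) \subset 'Z(Q).
  rewrite subsetI der_sub defQ' quotient_cents2r //.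
  by apply: subset_trans sWZ; rewrite commSg.
have cwQ := centers_within_quotient nZG cwY.
have sZP := subset_trans sZY sYP.
have nZY : 'Z(G) <| Y := normalS sZY sYG nZG.
have nZP : 'Z(G) <| P := normalS sZP sPG nZG.
have inY y : y \in G -> (coset 'Z(G) y \in Y / 'Z(G)) = (y \in Y).
  by move=> Gy; rewrite -[in RHS](quotientGK nZY) [RHS]inE [X in X && _](subsetP nZ) // inE.
have inP y : y \in G -> (coset 'Z(G) y \in P / 'Z(G)) = (y \in P).
  by move=> Gy; rewrite -[in RHS](quotientGK nZP) [RHS]inE [X in X && _](subsetP nZ) // inE.
(* The centralizer has index |Q'| = c, while it contains P/Z(G), whose index is at most c. *)
have cent_y y : y \in P -> y \notin Y -> 'C_Q[coset 'Z(G) y] = P / 'Z(G).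
  move=> Py nYy; have Gy := subsetP sPG y Py.
  have Qy : coset 'Z(G) y \in Q by rewrite mem_quotient.
  have nYQy : coset 'Z(G) y \notin Y / 'Z(G) by rewrite inY.
  have defQ'y := centers_within_comm sQ'Z cwQ Qy nYQy.
  apply/esym/eqP; rewrite eqEcard; apply/andP; split.
    rewrite subsetI quotientS // sub_cent1.
    by apply: (subsetP (quotient_cents2r sPPZ)); rewrite mem_quotient.
  have sPQ : P / 'Z(G) \subset Q by rewrite quotientS.
  rewrite -(leq_pmul2r (indexg_gt0 Q (P / 'Z(G)))) Lagrange //.
  rewrite -(Lagrange (subsetIl Q 'C[coset 'Z(G) y])) leq_mul2l index_cent1 classE_comm.
  have sGZP : G :&: 'Z(G) \subset P by rewrite subIset ?sZP ?orbT.
  by rewrite card_lcoset -defQ'y oQ' (index_quotient_eq sGZP sPG nZ) leGP orbT.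
have [g Gg nPg] : exists2 g, g \in G & g \notin P.
  apply/subsetPn; apply: contra nsG'Z => sGP; rewrite subsetI der_sub centsC.
  by apply: subset_trans sGP (subsetIr _ _).
(* Take g outside P. By [cent_y], elements of P commuting with g modulo Z(G) lie in Y, and the class
   of gZ(G) under P/Z(G) has at most |Q'| = c members. *)
have lePY : (#|P : Y| <= c)%N.
  have sZPY : P :&: 'Z(G) \subset Y by rewrite subIset ?sZY ?orbT.
  rewrite -(index_quotient_eq sZPY sYP (subset_trans sPG nZ)).
  apply: leq_trans (_ : #|P / 'Z(G) : 'C_(P / 'Z(G))[coset 'Z(G) g]| <= _)%N.
    apply: dvdn_leq; rewrite ?indexg_gt0 // indexgS //.
    apply/subsetP => _ /setIP[/morphimP[y Ny Py ->] cgy]; have Gy := subsetP sPG y Py.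
    rewrite inY //; apply: contraR nPg => nYy; rewrite -inP // -(cent_y y) //.
    by rewrite inE mem_quotient //= cent1C.
  rewrite index_cent1 classE_comm card_lcoset -oQ' subset_leq_card //.
  apply/subsetP => _ /imsetP[q Pq ->]; rewrite mem_commg ?mem_quotient //.
  by apply: (subsetP (quotientS _ sPG)).
by rewrite -(Lagrange_index sPG sYP) expnS expn1 leq_mul.
Qed.

(** Put W = [Y, G]. The center of G/W is Y/W, so [card_der1_bound] gives |G' : W|^2 <= |G : Y|. As W
    lies in both G' and Z(G), [index_centers_leq] gives the reverse bound, and equality forces both
    claims. *)
Lemma centers_class3 (gT : finGroupType) (G Y : {group gT}) (p : nat) :
    prime p -> p.-group G -> Y <| G -> G^`(1) \subset Y -> centers_within G Y ->
    [~: Y, G] \subset 'Z(G) -> #|[~: Y, G]| = p -> ~~ (G^`(1) \subset 'Z(G)) ->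
  #|G : Y| = (#|G^`(1) : [~: Y, G]| ^ 2)%N /\ G^`(1) :&: 'Z(G) = [~: Y, G].
Proof.
move=> p_pr pG nYG sG'Y cwY sWZ oW nsG'Z.
have leY := index_centers_leq p_pr pG nYG sG'Y cwY sWZ oW nsG'Z.
have [sYG _] := andP nYG.
set W := [~: Y, G]%G in oW sWZ *.
have nWG : W <| G := sub_center_normal sWZ.
have [sWG nW] := andP nWG.
have nWG' : G^`(1) \subset 'N(W) := subset_trans (der_sub 1 G) nW.
have sWG' : W \subset G^`(1) by rewrite commSg.
have sWY : W \subset Y by apply: subset_trans sG'Y.
have defZ : 'Z(G / W) = Y / W.
  apply/eqP; rewrite eqEsubset subsetI quotientS //= quotient_cents2r // andbT.
  apply/subsetP => x /centerP[Gx cx].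
  apply: (centers_within_quotient nWG cwY (normal1 _)) => // [|g Gg].
    rewrite -quotient_der // quotient_sub1 //.
    by apply: contra nsG'Z => sG'W; apply: subset_trans sG'W sWZ.
  by rewrite inE; apply/commgP/cx.
have : (#|(G / W)^`(1)| ^ 2 <= #|G / W : 'Z(G / W)|)%N.
  apply: (card_der1_bound p_pr); rewrite ?quotient_pgroup // defZ.
    by rewrite -quotient_der // quotientS.
  exact: centers_within_quotient.
rewrite defZ -quotient_der // card_quotient //.
rewrite index_quotient_eq // ?subIset ?sWY ?orbT // => geY.
have sWI : W \subset G^`(1) :&: 'Z(G) by rewrite subsetI sWG'.
have leI : (#|G^`(1) : G^`(1) :&: 'Z(G)| <= #|G^`(1) : W|)%N.
  by rewrite dvdn_leq ?indexg_gt0 ?indexgS.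
have eqI : #|G^`(1) : G^`(1) :&: 'Z(G)| = #|G^`(1) : W|.
  by apply/eqP; rewrite eqn_leq leI -(leq_exp2r _ _ (isT : (0 < 2)%N)) (leq_trans geY).
split; first by apply/eqP; rewrite eqn_leq geY andbT -eqI.
apply/esym/eqP; rewrite eqEcard sWI /=.
rewrite -(leq_pmul2r (indexg_gt0 G^`(1) W)) -{1}eqI !Lagrange //.
exact: subsetIl.
Qed.

(** * Semi-extraspecial groups *)

(** In G/M the derived subgroup has order p, and bounding centers with K = 1 identifies it with the
    center. The quotient by the center is elementary abelian, so the Frattini subgroup is no
    larger. *)
Lemma semi_extraspecial_centers_within (gT : finGroupType) (G : {group gT}) (p : nat) :
    prime p -> p.-group G -> G^`(1) = 'Z(G) -> centers_within G 'Z(G) ->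
  semi_extraspecial p G.
Proof.
move=> p_pr pG defG' cwZ; split=> // M sMZ iM.
have nMG : M <| G := sub_center_normal sMZ; have [sMG nM] := andP nMG.
have oR' : #|(G / M)^`(1)| = p.
  rewrite -quotient_der // defG' card_quotient ?iM //.
  exact: subset_trans (center_sub G) nM.
have ntR' : (G / M)^`(1) != 1.
  by rewrite -cardG_gt1 oR' prime_gt1.
have sR'Z : (G / M)^`(1) \subset 'Z(G / M).
  rewrite subsetI der_sub -quotient_der // quotient_cents2r // defG'.
  by have /commG1P-> := subsetIr G 'C(G); rewrite sub1G.
have cwR := centers_within_quotient nMG cwZ.
have defZ : 'Z(G / M) = (G / M)^`(1).
  apply/eqP; rewrite eqEsubset sR'Z andbT -quotient_der // defG'.
  apply/subsetP => x /centerP[Gx cx].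
  apply: (cwR 1%G (normal1 _)) => // [|g Gg]; first by rewrite subG1.
  by rewrite inE; apply/commgP/cx.
have pR : p.-group (G / M) by rewrite quotient_pgroup.
split; last by rewrite defZ oR'.
split=> //; apply/eqP; rewrite eqEsubset {2}defZ (Phi_joing pR) joing_subl andbT.
rewrite -(Phi_joing pR).
apply: (Phi_min pR); first exact: normal_norm (center_normal _).
apply: centers_within_abelem_quotient; rewrite ?center_normal //.
by rewrite /= defZ -quotient_der // defG'.
Qed.

(** * Chains of centers *)

Lemma cfZ_irr (gT : finGroupType) (G : {group gT}) (i : Iirr G) :
  cfZ ('chi_i)%R = 'Z('chi_i)%CF.
Proof. by rewrite /cfcenter irr_char. Qed.

(** This is Z(chi)/ker(chi) = Z(G/ker(chi)), read on elements. *)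
Lemma mem_cfcenter_comm (gT : finGroupType) (G : {group gT}) (i : Iirr G) x :
    x \in G ->
  (x \in 'Z('chi_i)%CF) = [forall g in G, [~ x, g] \in cfker 'chi_i].
Proof.
move=> Gx; have [sKG nK] := andP (cfker_normal 'chi_i).
have Nx := subsetP nK x Gx.
have -> : (x \in 'Z('chi_i)%CF) = (coset (cfker 'chi_i) x \in 'Z(G / cfker 'chi_i)).
  rewrite -cfcenter_eq_center -[in LHS](quotientGK (cfker_center_normal 'chi_i)).
  by rewrite [LHS]inE [X in X && _]Nx inE.
apply/centerP/forall_inP => [[_ cx] g Gg|cx].
  apply: coset_idr; first by rewrite groupR ?(subsetP nK).
  by rewrite morphR ?(subsetP nK) //; apply/eqP/commgP/cx; rewrite mem_quotient.
split=> [|_ /morphimP[g Ng Gg ->]]; first by rewrite mem_quotient.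
by apply/commgP; rewrite -morphR //= coset_id ?cx.
Qed.

Lemma sub_cfcenter_comm (gT : finGroupType) (G A : {group gT}) (i : Iirr G) :
    A \subset G ->
  (A \subset 'Z('chi_i)%CF) = ([~: A, G] \subset cfker 'chi_i).
Proof.
move=> sAG; rewrite gen_subG; apply/subsetP/subsetP => sA.
  move=> _ /imset2P[x g Ax Gg ->]; have Gx := subsetP sAG x Ax.
  by have := sA x Ax; rewrite mem_cfcenter_comm // => /forall_inP->.
move=> x Ax; rewrite mem_cfcenter_comm ?(subsetP sAG) //.
by apply/forall_inP => g Gg; apply: sA; apply/imset2P; exists x g.
Qed.

(** The kernels of the irreducible characters of G/K intersect trivially; one of these characters,
    nontrivial on the image of an element of A outside K, is inflated to G. *)
Lemma irr_separates_normal (gT : finGroupType) (G K A : {group gT}) :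
    K <| G -> A \subset G -> ~~ (A \subset K) ->
  exists2 i : Iirr G, K \subset cfker 'chi_i & ~~ (A \subset cfker 'chi_i).
Proof.
move=> nKG sAG /subsetPn[a Aa nKa]; have Ga := subsetP sAG a Aa.
have [sKG nK] := andP nKG; have Na := subsetP nK a Ga.
have : coset K a \notin \bigcap_i cfker 'chi[G / K]_i.
  by rewrite TI_cfker_irr inE; apply: contra nKa => /eqP; apply: coset_idr.
move=> nker; have [i nia] : exists i : Iirr (G / K), coset K a \notin cfker 'chi_i.
  apply/existsP; apply: contraR nker => /existsPn all_i.
  by apply/bigcapP => i _; have := all_i i; rewrite negbK.
exists (mod_Iirr i); rewrite mod_IirrE //; first exact: cfker_mod.
apply: contra nia => /subsetP/(_ a Aa).
by rewrite cfker_morph // !inE => /and3P[].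
Qed.

Lemma sub_chain_of_centers (gT : finGroupType) (G : {group gT})
    (X : nat -> {group gT}) n i j :
  chain_of_centers G X n -> (i <= j <= n)%N -> X j \subset X i.
Proof.
case=> _ X_dec _ _ /andP[]; elim: j => [|j IHj]; first by case: i.
rewrite leq_eqVlt => /predU1P[-> // | lt_ij] lt_jn.
exact: subset_trans (proper_sub (X_dec j lt_jn)) (IHj lt_ij (ltnW lt_jn)).
Qed.

Lemma chain_of_centers_normal (gT : finGroupType) (G : {group gT})
    (X : nat -> {group gT}) n k :
  chain_of_centers G X n -> (k <= n)%N -> X k <| G.
Proof.
by case=> _ _ _ X_cf /X_cf[i]; rewrite cfZ_irr => <-; apply: cfcenter_normal.
Qed.

(** A character whose kernel contains K but not [X_j, G] has center X_k not containing X_j, so k >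
    j, while x lies in X_k. *)
Lemma chain_of_centers_step (gT : finGroupType) (G K : {group gT})
    (X : nat -> {group gT}) n j x :
    chain_of_centers G X n -> (j < n)%N ->
    K <| G -> ~~ ([~: X j, G] \subset K) ->
    x \in G -> (forall g, g \in G -> [~ x, g] \in K) ->
  x \in X j.+1.
Proof.
move=> chX lt_jn nKG nsK Gx xK; have [_ _ cf_X _] := chX.
have sXG : X j \subset G by apply/normal_sub/(chain_of_centers_normal chX)/ltnW.
have sWG : [~: X j, G] \subset G by rewrite comm_subG.
have [i sKi nsi] := irr_separates_normal nKG sWG nsK.
have [k le_kn] := cf_X i; rewrite cfZ_irr => defZ.
have lt_jk : (j < k)%N.
  rewrite ltnNge; apply: contra nsi => le_kj.
  rewrite -sub_cfcenter_comm // defZ.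
  by apply: sub_chain_of_centers chX _; rewrite le_kj ltnW.
apply: (subsetP (_ : X k \subset _)).
  by apply: sub_chain_of_centers chX _; rewrite lt_jk.
rewrite -defZ mem_cfcenter_comm //.
by apply/forall_inP => g Gg; apply: (subsetP sKi); apply: xK.
Qed.

(** Otherwise [chain_of_centers_step] with K = X_(j+1) makes the center of the p-group G/X_(j+1)
    trivial, so G = X_(j+1), against X_(j+1) < X_j. *)
Lemma chain_of_centers_comm (gT : finGroupType) (G : {group gT})
    (X : nat -> {group gT}) n j (p : nat) :
    p.-group G -> chain_of_centers G X n -> (j < n)%N ->
  [~: X j, G] \subset X j.+1.
Proof.
move=> pG chX lt_jn; apply/idPn => nsX.
have nXG := chain_of_centers_normal chX lt_jn; have [sXG nX] := andP nXG.
have nXjG := chain_of_centers_normal chX (ltnW lt_jn).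
have : 'Z(G / X j.+1) == 1.
  rewrite -subG1; apply/subsetP => _ /centerP[/morphimP[x Nx Gx ->] cx].
  rewrite inE; apply/eqP/coset_id; apply: (chain_of_centers_step chX lt_jn nXG nsX Gx).
  move=> g Gg; apply: coset_idr; first by rewrite groupR ?(subsetP nX).
  by rewrite morphR ?(subsetP nX) //; apply/eqP/commgP/cx; rewrite mem_quotient.
rewrite (center_nil_eq1 (pgroup_nil (quotient_pgroup _ pG))) -subG1 quotient_sub1 //.
have [_ /(_ j lt_jn)/proper_subn/negP nsXj _ _] := chX => sGX; case: nsXj.
exact: subset_trans (normal_sub nXjG) sGX.
Qed.

Lemma chain_of_centers_gt0 (gT : finGroupType) (G : {group gT})
    (X : nat -> {group gT}) n :
  ~~ abelian G -> chain_of_centers G X n -> (0 < n)%N.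
Proof.
move=> nabG chX; have [X0 _ cf_X _] := chX.
have [|||i _ nsi] := @irr_separates_normal _ G 1%G (G^`(1))%G; rewrite ?normal1 ?der_sub //.
  by rewrite subG1; apply: contra nabG => /eqP/derG1P.
have [[|k] le_kn] := cf_X i; last by move=> _; apply: leq_ltn_trans le_kn.
by rewrite cfZ_irr X0 => defZ; case/negP: nsi; rewrite -sub_cfcenter_comm ?defZ.
Qed.

(** If X_j = Z(chi), the quotient G/Z(chi) is abelian, so |G : Z(chi)| = chi(1)^2. *)
Lemma chain_of_centers_square (gT : finGroupType) (G : {group gT})
    (X : nat -> {group gT}) n j :
    chain_of_centers G X n -> (j <= n)%N -> G^`(1) \subset X j ->
  exists m, #|G : X j| = (m ^ 2)%N.
Proof.
move=> chX le_jn sG'X; have [_ _ _ X_cf] := chX.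
have [i] := X_cf j le_jn; rewrite cfZ_irr => defZ.
have := @irr1_abelian_bound _ G i.
rewrite defZ irr1_degree sub_der1_abelian // -natrX => /(_ isT)/eqP.
by rewrite eqr_nat => /eqP <-; eexists.
Qed.

Lemma center_quotient_eq (gT : finGroupType) (G N Y : {group gT}) :
    N <| G -> Y \subset G -> [~: Y, G] \subset N ->
    (forall x, x \in G -> (forall g, g \in G -> [~ x, g] \in N) -> x \in Y) ->
  'Z(G / N) = Y / N.
Proof.
move=> nNG sYG sYGN cwY; have [_ nN] := andP nNG.
apply/eqP; rewrite eqEsubset subsetI quotientS //= quotient_cents2r // andbT.
apply/subsetP => _ /centerP[/morphimP[x Nx Gx ->] cx]; apply: mem_quotient.
apply: cwY => // g Gg; apply: coset_idr; first by rewrite groupR ?(subsetP nN).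
by rewrite morphR ?(subsetP nN) //; apply/eqP/commgP/cx; rewrite mem_quotient.
Qed.

(** Since Y = NG', the subgroup Y/N is both the center and the derived subgroup of G/N. The center
    is returned too, for the order count in the ultraspecial case. *)
Lemma semi_extraspecial_quotient (gT : finGroupType) (G N Y : {group gT}) (p : nat) :
    prime p -> p.-group G -> N <| G -> Y \subset G -> centers_within G Y ->
    [~: Y, G] \subset N -> N \proper N * G^`(1) -> N * G^`(1) = Y ->
  'Z(G / N) = Y / N /\ semi_extraspecial p (G / N).
Proof.
move=> p_pr pG nNG sYG cwY sYGN pN defY; have [_ nN] := andP nNG.
have nsG'N : ~~ (G^`(1) \subset N).
  by apply: contraL pN => sG'N; rewrite mulGSid ?properxx.
have defZ : 'Z(G / N) = Y / N by apply: center_quotient_eq => //; apply: cwY.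
split=> //; apply: semi_extraspecial_centers_within; rewrite ?quotient_pgroup //=.
  by rewrite defZ -defY quotientMidl quotient_der.
by rewrite defZ; apply: centers_within_quotient.
Qed.

Lemma expp_center (gT : finGroupType) (G Y : {group gT}) (p : nat) :
    Y \subset G -> [~: Y, G] \subset 'Z(G) -> #|[~: Y, G]| = p ->
  forall y, y \in Y -> y ^+ p \in 'Z(G).
Proof.
move=> sYG sWZ oW y Yy; have Gy := subsetP sYG y Yy.
apply/centerP; split=> [|g Gg]; first exact: groupX.
have Wyg : [~ y, g] \in [~: Y, G] by rewrite mem_commg.
apply/commgP; rewrite commXg -?oW ?expg_cardG //.
by have /centerP[_ cyg] := subsetP sWZ _ Wyg; apply/commute_sym/cyg.
Qed.

Lemma chain_of_centers_class3 (gT : finGroupType) (G : {group gT})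
    (X : nat -> {group gT}) n (p : nat) :
    prime p -> p.-group G -> chain_of_centers G X n -> (1 < n)%N ->
    ~~ (G^`(1) \subset X 2%N) ->
  [/\ #|G : X 1%N| = (#|G^`(1) : [~: X 1%N, G]| ^ 2)%N,
      X 2%N :&: G^`(1) = [~: X 1%N, G] & p.-abelem (X 1%N / X 2%N)].
Proof.
move=> p_pr pG chX lt1n nsG'X2; have lt0n := ltnW lt1n.
have [X0 X_dec _ X_cf] := chX.
have nX1G := chain_of_centers_normal chX lt0n; have [sX1G nX1] := andP nX1G.
have nX2G := chain_of_centers_normal chX lt1n; have [sX2G nX2] := andP nX2G.
have sX21 : X 2 \subset X 1%N := proper_sub (X_dec 1%N lt1n).
have sG'X1 : G^`(1) \subset X 1%N.
  by have := chain_of_centers_comm pG chX lt0n; rewrite X0.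
have sW1X2 := chain_of_centers_comm pG chX lt1n.
have cwX1 : centers_within G (X 1%N).
  move=> K nKG nsG'K x; apply: chain_of_centers_step chX lt0n nKG _.
  by rewrite X0.
have sW21 : [~: X 2, G] \subset [~: X 1%N, G] by rewrite commSg.
(* If X_2 = Z(chi), then ker(chi) contains [X_2, G]; if it contained [X_1, G] as well, X_1 would lie
   in X_2. *)
have nsW12 : ~~ ([~: X 1%N, G] \subset [~: X 2, G]).
  have [i] := X_cf 2 lt1n; rewrite cfZ_irr => defZ.
  have := proper_subn (X_dec 1%N lt1n); apply: contra => sW12.
  rewrite -defZ sub_cfcenter_comm // (subset_trans sW12) //.
  by rewrite -sub_cfcenter_comm // defZ.
have [eqW|[M maxM sW2M]] := maximal_exists sW21.
  by rewrite eqW subxx in nsW12.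
have [sMW1 nsW1M] := andP (maxgroupp maxM).
have sMX2 := subset_trans sMW1 sW1X2.
have sMX1 := subset_trans sMX2 sX21.
have sW1G : [~: X 1%N, G] \subset G by rewrite comm_subG.
have sMG := subset_trans sMW1 sW1G.
(* M lies in X_2, so [M, G] <= [X_2, G] <= M. *)
have nMG : M <| G.
  rewrite /normal sMG -commg_subl (subset_trans _ sW2M) //.
  by rewrite commSg.
have [_ nM] := andP nMG.
have iM : #|[~: X 1%N, G] : M| = p := p_maximal_index (pgroupS sW1G pG) maxM.
have defZ : 'Z(G / M) = X 2 / M.
  apply: center_quotient_eq => // x; exact: chain_of_centers_step chX lt1n nMG nsW1M.
have defW : [~: X 1%N / M, G / M] = [~: X 1%N, G] / M.
  by rewrite quotientR // (subset_trans sX1G).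
have oW : #|[~: X 1%N / M, G / M]| = p.
  by rewrite defW card_quotient // (subset_trans sW1G).
have sWZ : [~: X 1%N / M, G / M] \subset 'Z(G / M) by rewrite defW defZ quotientS.
have nMG' : G^`(1) \subset 'N(M) := subset_trans (der_sub 1 G) nM.
have sW1G' : [~: X 1%N, G] \subset G^`(1) by rewrite commSg.
have [] := @centers_class3 _ (G / M) (X 1%N / M) p p_pr _ _ _ _ sWZ oW _.
- exact: quotient_pgroup.
- exact: quotient_normal.
- by rewrite -quotient_der // quotientS.
- exact: centers_within_quotient.
- by rewrite defZ -quotient_der // quotientSGK.
rewrite defZ defW -quotient_der //=.
rewrite !index_quotient_eq ?subIset ?sMW1 ?sMX1 ?orbT // => idx eqI.
have eqW : X 2 :&: G^`(1) = [~: X 1%N, G].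
  have sMI : M \subset X 2 :&: G^`(1) by rewrite subsetI sMX2 (subset_trans sMW1).
  apply: (@quotient_inj _ M (X 2 :&: G^`(1))%G [~: X 1%N, G]%G).
  - by apply: normalS nMG; rewrite ?subIset ?sX2G.
  - exact: normalS nMG.
  by rewrite /= (quotientGI _ sMX2) setIC.
split=> //; apply/abelemP => //; split.
  by rewrite sub_der1_abelian // (subset_trans _ sW1X2) // commgS.
move=> _ /morphimP[x Nx X1x ->]; rewrite -morphX //=; apply: coset_id.
(* Modulo M, p-th powers of elements of X_1 are central, and the center is X_2/M. *)
have /expp_center/(_ sWZ oW) xpZ : X 1%N / M \subset G / M by rewrite quotientS.
have Gx := subsetP sX1G x X1x.
have nMX2 : M <| X 2 by apply: normalS nMG.
rewrite -(quotientGK nMX2) mem_morphpre //=; first by rewrite groupX ?(subsetP nM).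
by rewrite -defZ morphX ?(subsetP nM) // xpZ ?mem_quotient.
Qed.

(** A is the preimage of a complement of DZ/Z in Y/Z; it is normal because [A, G] <= [Y, G] <= Z <=
    A. Taking D = G' yields A with AG' = X_1. *)
Lemma abelem_quotient_complement (gT : finGroupType) (G Y Z D : {group gT}) (p : nat) :
    Z <| G -> Z \subset Y -> Y \subset G -> [~: Y, G] \subset Z ->
    p.-abelem (Y / Z) -> D \subset Y ->
  exists A : {group gT},
    [/\ A <| G, Z \subset A, A \subset Y, A * D = Y & #|Y : A| = #|D / Z| ].
Proof.
move=> nZG sZY sYG sYGZ abY sDY; have [sZG nZ] := andP nZG.
have nZY : Z <| Y := normalS sZY sYG nZG.
have nZD := subset_trans (subset_trans sDY sYG) nZ.
have sDZ : D / Z \subset Y / Z := quotientS _ sDY.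
have [C defC] := abelem_split_dprod abY sDZ.
have [_ mulDC _ _] := dprodP defC.
have sCY : C \subset Y / Z by rewrite -mulDC mulG_subr.
have [A defA sZA sAY] := inv_quotientS nZY sCY.
have nZA := subset_trans (subset_trans sAY sYG) nZ.
have nAG : A <| G.
  rewrite /normal (subset_trans sAY sYG) -commg_subl.
  by rewrite (subset_trans (commSg _ sAY)) // (subset_trans sYGZ).
have nAD : D \subset 'N(A) := subset_trans (subset_trans sDY sYG) (normal_norm nAG).
exists A; split=> //.
  rewrite -(norm_joinEr nAD); apply: (@quotient_inj _ Z (A <*> D)%G Y) => //.
    apply: normalS nZG; first by rewrite (subset_trans sZA) ?joing_subl.
    by rewrite join_subG (subset_trans sAY) ?(subset_trans sDY).
  rewrite /= (norm_joinEr nAD) quotientMl // -mulDC defA.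
  by apply: esym; apply: normC; apply: quotient_norms.
have sZYA : Y :&: Z \subset A by rewrite subIset ?sZA ?orbT.
rewrite -(index_quotient_eq sZYA sAY (subset_trans sYG nZ)) -defA.
apply/eqP; rewrite -(eqn_pmul2l (cardG_gt0 C)) Lagrange //.
by rewrite -(dprod_card defC) mulnC.
Qed.

Theorem theorem1p5 (p : nat) (gT : finGroupType) (G : {group gT})
    (X : nat -> {group gT}) (n : nat) :
  prime p -> p.-group G -> ~~ abelian G -> nested G -> chain_of_centers G X n ->
  [/\ (* (1) *)
      (exists m, #|G : X 1%N| = (m ^ 2)%N),
      (* (2) *)
      (forall i, (1 <= i <= n)%N -> G^`(1) \subset X i ->
         forall j, (1 <= j <= i)%N -> exists m, #|G : X j| = (m ^ 2)%N),
      (* (3) *)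
      (forall N : {group gT}, N <| G -> [~: X 1%N, G] \subset N ->
         N \proper N * G^`(1) -> N * G^`(1) = X 1%N ->
         semi_extraspecial p (G / N))
    & (* (4) *)
      ((2 <= n)%N -> X 2%N \proper X 2%N * G^`(1) ->
       [/\ #|G : X 1%N| = (#|X 2%N * G^`(1) : X 2%N| ^ 2)%N,
           #|G : X 1%N| = (#|G^`(1) : [~: X 1%N, G]| ^ 2)%N,
           X 2%N :&: G^`(1) = [~: X 1%N, G]
         & exists A : {group gT},
             [/\ A <| G, X 2%N \subset A, A \proper X 1%N & ultraspecial p (G / A)]])].
Proof.
move=> p_pr pG nabG _ chX; have n_gt0 := chain_of_centers_gt0 nabG chX.
have [X0 X_dec _ _] := chX.
have nX1G := chain_of_centers_normal chX n_gt0; have [sX1G nX1] := andP nX1G.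
have sG'X1 : G^`(1) \subset X 1%N.
  by have := chain_of_centers_comm pG chX n_gt0; rewrite X0.
have cwX1 : centers_within G (X 1%N).
  move=> K nKG nsG'K x; apply: chain_of_centers_step chX n_gt0 nKG _.
  by rewrite X0.
split.
- exact: chain_of_centers_square chX n_gt0 sG'X1.
- move=> i /andP[_ le_in] sG'Xi j /andP[_ le_ji].
  apply: (chain_of_centers_square chX (leq_trans le_ji le_in)).
  by rewrite (subset_trans sG'Xi) // (sub_chain_of_centers chX) ?le_ji.
- move=> N nNG sWN pN defX1.
  by have [] := semi_extraspecial_quotient p_pr pG nNG sX1G cwX1 sWN pN defX1.
move=> lt1n pX2.
have nX2G := chain_of_centers_normal chX lt1n; have [sX2G nX2] := andP nX2G.
have nsG'X2 : ~~ (G^`(1) \subset X 2%N).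
  by apply: contraL pX2 => sG'X2; rewrite mulGSid ?properxx.
have [idx eqW abX] := chain_of_centers_class3 p_pr pG chX lt1n nsG'X2.
have sX21 : X 2%N \subset X 1%N := proper_sub (X_dec 1%N lt1n).
have sW1X2 := chain_of_centers_comm pG chX lt1n.
have nX2G' : G^`(1) \subset 'N(X 2%N) := subset_trans (der_sub 1 G) nX2.
have idx2 : #|X 2%N * G^`(1) : X 2%N| = #|G^`(1) : [~: X 1%N, G]|.
  by rewrite indexMg -indexgI setIC eqW.
split; rewrite ?idx2 //.
(* A complements G' in X_1 modulo X_2, so the argument for (3) applies to G/A. *)
have [A [nAG sX2A sAX1 defX1 iA]] :=
  abelem_quotient_complement nX2G sX21 sX1G sW1X2 abX sG'X1.
(* A = X_1 would make the image of G' in G/X_2 trivial. *)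
have pA : A \proper X 1%N.
  rewrite properEneq sAX1 andbT; apply: contra nsG'X2 => /eqP eqA.
  move: iA; rewrite eqA indexgg => /esym/eqP; rewrite -trivg_card1.
  by rewrite -subG1 quotient_sub1.
exists A; split=> //.
have sWA := subset_trans sW1X2 sX2A.
have pA' : A \proper A * G^`(1) by rewrite defX1.
have [defZ semiA] := semi_extraspecial_quotient p_pr pG nAG sX1G cwX1 sWA pA' defX1.
(* The center of G/A has order |X_1 : A| = |G' : [X_1, G]|, whose square is |G : X_1|. *)
split=> //; have nA := normal_norm nAG; rewrite defZ.
rewrite (index_quotient_eq _ sX1G nA) ?subIset ?sAX1 ?orbT //.
rewrite card_quotient ?(subset_trans sX1G) // iA idx card_quotient_index //.
by rewrite eqW.
Qed.
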